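(* Let $\{Y_i\}_{i=1}^{\infty}$ be a stationary Markov chain with state space $[N]$, transition matrix $A$, stationary probability measure $\pi$, and averaging operator $E_{\pi}$, so that $Y_1$ is distributed according to $\pi$. Let $\lambda = \|A-E_{\pi}\|_{L_2(\pi) \rightarrow L_2(\pi)}$ and let $f_1, \ldots, f_n: [N] \rightarrow \mathbb{R}$ be such that $\mathbb{E}[f_i(Y_i)] = 0$ for all $i$ and $|f_i(v)| \leq a_i$ for all $v \in [N]$ and all $i$. Then for $u \geq 0$, \[ \Pr\left[|f_1(Y_1)+\cdots+f_n(Y_n)| \geq u\left(\sum_{i=1}^n a_i^2\right)^{1/2} \right] \leq 2\exp\left(-u^2(1-\lambda)/(64e)\right). \]
   Context: $[N]=\{1,\ldots,N\}$, and $a_1,\ldots,a_n$ are real numbers. The transition matrix $A\in\mathbb{R}^{N\times N}$ is row-stochastic, with $A_{ij}$ the probability of moving from $i$ to $j$, and $\pi$ is a probability distribution on $[N]$ with positive entries satisfying $\sum_i \pi_i A_{ij}=\pi_j$ for all $j$. The chain is not assumed to be reversible. The averaging operator $E_\pi\in\mathbb{R}^{N\times N}$ is the matrix $(E_\pi)_{ij}=\pi_j$. For $v\in\mathbb{R}^N$, $\|v\|_{L_2(\pi)}=\left(\sum_{i=1}^N \pi_i |v_i|^2\right)^{1/2}$, and for $T\in\mathbb{R}^{N\times N}$, $\|T\|_{L_2(\pi)\to L_2(\pi)}=\max_{v:\|v\|_{L_2(\pi)}=1}\|Tv\|_{L_2(\pi)}$. Here $e$ is the base of the natural logarithm.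
   Formalization: The formal theorem assumes that some a_i is nonzero (so n ≥ 1); if all a_i = 0, the event has probability 1 for every u, while the right-hand side falls below 1 for large u when λ < 1, so the printed claim fails. *)

(* Defs.v *)
From mathcomp Require Import all_boot all_order all_algebra.
From mathcomp Require Import all_classical all_reals all_analysis.

Set Implicit Arguments.
Unset Strict Implicit.
Unset Printing Implicit Defensive.

Import Order.TTheory GRing.Theory Num.Theory.

Local Open Scope classical_set_scope.
Local Open Scope ring_scope.

Section WeightedL2.
Context {R : realType} {N : nat}.
Implicit Types (mu : 'rV[R]_N) (A T : 'M[R]_N) (v : 'cV[R]_N).

Definition row_stochastic A : Prop :=
  (forall i j, 0 <= A i j) /\ (forall i, \sum_j A i j = 1).

Definition positive_distribution mu : Prop :=
  (forall i, 0 < mu 0 i) /\ \sum_i mu 0 i = 1.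

Definition stationary_distribution mu A : Prop := mu *m A = mu.

Definition averaging_mx mu : 'M[R]_N := \matrix_(i, j) mu 0 j.

Definition L2norm mu v : R := Num.sqrt (\sum_i mu 0 i * `|v i 0| ^+ 2).

(* The unit sphere is compact and nonempty when [mu] is a positive
   distribution, so this supremum is a maximum. *)
Definition L2opnorm mu T : R :=
  sup [set L2norm mu (T *m v) | v in [set v | L2norm mu v = 1]].

End WeightedL2.

Section MarkovChain.
Context {R : realType} {d : measure_display} {Omega : measurableType d}.
Variable P : probability Omega R.

(* Only meaningful when [P F != 0]. *)
Definition cond_prob (E F : set Omega) : R :=
  fine (P (E `&` F)) / fine (P F).

(* ['I_N] carries no sigma-algebra in the library; measurability for the
   discrete one amounts to measurability of the fibres.  Time starts at 0. *)
Record stationary_markov_chain (N : nat) (A : 'M[R]_N) (mu : 'rV[R]_N)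
    (Y : nat -> Omega -> 'I_N) : Prop := StationaryMarkovChain {
  chain_measurable : forall k i, measurable (Y k @^-1` [set i]);
  chain_row_stochastic : row_stochastic A;
  chain_stationary : stationary_distribution mu A;
  chain_initial : forall i, P (Y 0%N @^-1` [set i]) = (mu 0 i)%:E;
  chain_markov : forall (k : nat) (x : nat -> 'I_N) (j : 'I_N),
    let past := [set w | forall l, (l <= k)%N -> Y l w = x l] in
    P past != 0%E ->
    cond_prob (Y k.+1 @^-1` [set j]) past = A (x k) j }.

End MarkovChain.

(* Main.v *)
Require Import Defs.
From mathcomp Require Import all_boot all_order all_algebra.
From mathcomp Require Import ring lra.
From mathcomp Require Import all_classical all_reals all_analysis.
From mathcomp Require Import measurable_realfun.

Set Implicit Arguments.
Unset Strict Implicit.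
Unset Printing Implicit Defensive.

Import Order.TTheory GRing.Theory Num.Theory.

Local Open Scope classical_set_scope.
Local Open Scope ring_scope.

(* Write <x> for the mean of x under mu and let lam < 1 be the operator norm.
   The quadratic form Q(x) = lam <x^2> + (1 - lam) <x>^2 controls A without
   reversibility: <x, A y>^2 <= Q(x) Q(y).  If |f| <= b and <f> = 0, a second
   order expansion gives Q(e^(f/2) g) <= K <g^2> with
   K = exp(32 b^2 / (1 - lam)); testing the bilinear bound on
   g = e^(f/2) A y then yields Q(e^f A y) <= K^2 Q(y).  Iterating along the
   chain bounds the moment generating function of the sum by
   exp(32 t^2 sum_i a_i^2 / (1 - lam)), and Chernoff's bound gives tails
   exp(-u^2 (1 - lam) / 128), which suffices since 128 <= 64 e. *)

(** * Elementary real inequalities *)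

Section RealInequalities.
Context {R : realType}.
Implicit Types x y z b c d : R.

(** AM-GM in the form [4 * (y * z) <= (y + z) ^+ 2]. It splits a cross term of either sign into two
    nonnegative terms without square roots. *)
Lemma le_addr_of_sqr x y z :
  0 <= y -> 0 <= z -> x ^+ 2 <= 4 * (y * z) -> x <= y + z.
Proof.
move=> y0 z0 xyz; rewrite leNgt; apply/negP => yzx.
have : (y + z) ^+ 2 < x ^+ 2 by rewrite ltr_pXn2r// nnegrE; lra.
have := sqr_ge0 (y - z); nra.
Qed.

(** From [1 - x <= expR (- x)] one gets [expR x * (1 - x) <= 1], while (1 - x)(1 + x + 2x^2) = 1 +
    x^2 (1 - 2x) is at least 1 when x <= 1/2. *)
Lemma expR_le_quad x : x <= 1 / 2 -> expR x <= 1 + x + 2 * x ^+ 2.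
Proof.
move=> x12.
have h1 : 1 - x <= expR (- x) by exact: expR_ge1Dx.
have h2 : expR x * expR (- x) = 1 by rewrite -expRD subrr expR0.
have x2 := sqr_ge0 x; have ex0 := expR_gt0 x.
have h3 : expR x * (1 - x) <= 1 by rewrite -[leRHS]h2 ler_pM2l.
have h4 : 0 <= x ^+ 2 * (1 - 2 * x) by apply: mulr_ge0 => //; lra.
have h5 : 0 < 1 - x by lra.
by rewrite -(ler_pM2r h5); lra.
Qed.

Lemma expR_dist_le x : `|x| <= 1 / 2 -> `|expR x - 1| <= 2 * `|x|.
Proof.
move=> x12.
have xl : x <= 1 / 2 by apply: le_trans x12; exact: ler_norm.
have h1 := expR_le_quad xl; have h2 := expR_ge1Dx x.
have h3 : x ^+ 2 = `|x| ^+ 2 by rewrite real_normK// num_real.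
have h4 := normr_ge0 x; have h5 := ler_norm x; have h6 : - x <= `|x|.
  by rewrite -normrN ler_norm.
rewrite ler_norml; apply/andP; split; nra.
Qed.

(** Scalar core of the tilt estimate. Here [c] and [V] stand for the mean and variance of g, [q] for
    the mean of e^(f/2), [E] for the second moment of e^(f/2) g, and [s], [r] for the correlations
    of g - c with e^(f/2) - 1 and with f. Terms of first order in [b] always carry the fluctuation
    of g, so the gap [1 - lam] can absorb them. *)
Lemma tilt_arith lam b c V E q s r :
  0 <= lam -> lam < 1 -> 0 <= b -> 32 * b <= 1 - lam -> 0 <= V ->
  1 <= q -> q <= 1 + b ^+ 2 / 2 -> s ^+ 2 <= b ^+ 2 * V ->
  r ^+ 2 <= b ^+ 2 * V ->
  E <= (1 + 2 * b ^+ 2) * (c ^+ 2 + V) + 2 * c * r + b * V ->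
  lam * E + (1 - lam) * (c * q + s) ^+ 2
    <= (1 + 32 * b ^+ 2 / (1 - lam)) * (c ^+ 2 + V).
Proof.
move=> lam0 lam1 b0 bd V0 q1 qb sb rb Eb.
have d0 : 0 < 1 - lam by lra.
pose w := b ^+ 2 / (1 - lam).
have ew : b ^+ 2 = w * (1 - lam) by rewrite /w mulfVK// gt_eqF.
have w0 : 0 <= w by rewrite divr_ge0 ?sqr_ge0// ltW.
have c0 := sqr_ge0 c; have e0 := sqr_ge0 b.
have e1 : b ^+ 2 <= b / 32 by nra.
have q4 : q ^+ 2 <= 1 + 2 * b ^+ 2 by nra.
(* This cross term is only first order in [b]. A quarter of the gap times [V] pays for it, which
   leaves a second order multiple of [c ^+ 2]; the division by the gap in [w] arises here. *)
have cr : 2 * c * r <= (1 - lam) / 4 * V + 4 * w * c ^+ 2.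
  apply: le_addr_of_sqr; [by apply: mulr_ge0 => //; lra| |].
    by apply: mulr_ge0 => //; lra.
  have -> : 4 * ((1 - lam) / 4 * V * (4 * w * c ^+ 2))
      = 4 * c ^+ 2 * (b ^+ 2 * V) by rewrite ew; field.
  have -> : (2 * c * r) ^+ 2 = 4 * c ^+ 2 * r ^+ 2 by ring.
  by apply: ler_wpM2l => //; lra.
have cs : 2 * q * c * s <= V / 4 + 16 * b ^+ 2 * c ^+ 2.
  apply: le_addr_of_sqr; [lra|by apply: mulr_ge0 => //; lra|].
  have -> : (2 * q * c * s) ^+ 2 = 4 * c ^+ 2 * (q ^+ 2 * s ^+ 2) by ring.
  have -> : 4 * (V / 4 * (16 * b ^+ 2 * c ^+ 2))
      = 4 * c ^+ 2 * (4 * (b ^+ 2 * V)) by field.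
  apply: ler_wpM2l; first lra.
  by apply: ler_pM; rewrite ?sqr_ge0//; lra.
have sq : (c * q + s) ^+ 2
    <= c ^+ 2 * (1 + 2 * b ^+ 2) + V / 4 + 16 * b ^+ 2 * c ^+ 2 + b ^+ 2 * V.
  have : c ^+ 2 * q ^+ 2 <= c ^+ 2 * (1 + 2 * b ^+ 2) by exact: ler_wpM2l.
  lra.
rewrite -mulrA -/w.
set S := (X in _ <= X) in sq; set M := (X in _ <= X) in cr.
have M0 : 0 <= M.
  by apply: addr_ge0; apply: mulr_ge0 => //; lra.
have E1 : lam * E <= lam * ((1 + 2 * b ^+ 2) * (c ^+ 2 + V) + b * V) + M.
  have : lam * E
      <= lam * ((1 + 2 * b ^+ 2) * (c ^+ 2 + V) + 2 * c * r + b * V).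
    exact: ler_wpM2l.
  have : lam * (2 * c * r) <= lam * M by exact: ler_wpM2l.
  have : lam * M <= 1 * M by apply: ler_wpM2r => //; lra.
  lra.
have S1 : (1 - lam) * (c * q + s) ^+ 2 <= (1 - lam) * S.
  by apply: ler_wpM2l => //; lra.
apply: (le_trans (lerD E1 S1)).
(* Compare coefficients: since [b ^+ 2 <= w], that of [c ^+ 2] is at most 1 + 22 w; in that of [V],
   the terms lam + (1 - lam)/2 leave room for [b], which is at most (1 - lam)/32. *)
have -> : lam * ((1 + 2 * b ^+ 2) * (c ^+ 2 + V) + b * V) + M + (1 - lam) * S
  = c ^+ 2 * (1 + 2 * b ^+ 2 + 16 * (1 - lam) * b ^+ 2 + 4 * w)
    + V * (lam * (1 + 2 * b ^+ 2 + b) + (1 - lam) / 2 + (1 - lam) * b ^+ 2).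
  by rewrite /S /M; field.
rewrite [X in _ <= X]mulrC [X in _ <= X]mulrDl.
by apply: lerD; apply: ler_wpM2l => //; nra.
Qed.

End RealInequalities.

(** * Means under a positive distribution *)

Section Mean.
Context {R : realType} {N : nat}.
Implicit Types (mu : 'rV[R]_N) (x y : 'I_N -> R) (A : 'M[R]_N).

Definition mean mu x : R := \sum_i mu 0 i * x i.

Lemma eq_mean mu x y : x =1 y -> mean mu x = mean mu y.
Proof. by move=> xy; apply: eq_bigr => i _; rewrite xy. Qed.

Lemma meanD mu x y : mean mu (fun i => x i + y i) = mean mu x + mean mu y.
Proof. by rewrite -big_split; apply: eq_bigr => i _; rewrite mulrDr. Qed.

Lemma meanZ mu (c : R) x : mean mu (fun i => c * x i) = c * mean mu x.
Proof. by rewrite mulr_sumr; apply: eq_bigr => i _; rewrite mulrCA. Qed.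

Section Positive.
Context (mu : 'rV[R]_N) (hmu : positive_distribution mu).

Lemma mean_cst (c : R) : mean mu (fun=> c) = c.
Proof. by rewrite /mean -mulr_suml (proj2 hmu) mul1r. Qed.

Lemma le_mean x y : (forall i, x i <= y i) -> mean mu x <= mean mu y.
Proof.
by move=> xy; apply: ler_sum => i _; rewrite ler_wpM2l// ltW// (proj1 hmu).
Qed.

Lemma mean_ge0 x : (forall i, 0 <= x i) -> 0 <= mean mu x.
Proof. by move=> x0; rewrite -(mean_cst 0); exact: le_mean. Qed.

Lemma mean_sqr_ge0 x : 0 <= mean mu (fun i => x i ^+ 2).
Proof. by apply: mean_ge0 => i; exact: sqr_ge0. Qed.

(** The mean of (s x + t y)^2 is nonnegative. With X, Y the second moments and p the mixed one, (s,
    t) = (Y, -p) gives Y (XY - p^2) >= 0, and symmetrically for X; if both vanish, (1, 1) and (1,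
    -1) force p = 0. *)
Lemma mean_cauchy_schwarz x y :
  mean mu (fun i => x i * y i) ^+ 2
    <= mean mu (fun i => x i ^+ 2) * mean mu (fun i => y i ^+ 2).
Proof.
have key s t : 0 <= s ^+ 2 * mean mu (fun i => x i ^+ 2)
    + (2 * s * t) * mean mu (fun i => x i * y i)
    + t ^+ 2 * mean mu (fun i => y i ^+ 2).
  rewrite -!meanZ -!meanD; apply: mean_ge0 => i.
  by have := sqr_ge0 (s * x i + t * y i); rewrite /=; lra.
move: (mean_sqr_ge0 x) (mean_sqr_ge0 y) key.
move: (mean mu (fun i => x i * y i)) (mean mu (fun i => x i ^+ 2)).
move: (mean mu (fun i => y i ^+ 2)) => Y p X X0 Y0 key.
have [Yp|Yn] := ltP 0 Y.
  have : 0 <= Y * (X * Y - p ^+ 2) by have := key Y (- p); lra.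
  by rewrite pmulr_rge0// subr_ge0.
have [Xp|Xn] := ltP 0 X.
  have : 0 <= X * (X * Y - p ^+ 2) by have := key (- p) X; lra.
  by rewrite pmulr_rge0// subr_ge0.
have := key 1 1; have := key 1 (- 1).
have -> : X = 0 by lra.
have -> : Y = 0 by lra.
move=> h1 h2; have -> : p = 0 by lra.
lra.
Qed.

Lemma sqr_mean_le x : mean mu x ^+ 2 <= mean mu (fun i => x i ^+ 2).
Proof.
have := mean_cauchy_schwarz (fun=> 1) x.
rewrite (@eq_mean _ (fun i => 1 * x i) x) => [|i]; last by rewrite mul1r.
by under [X in X * _]eq_mean do rewrite expr1n; rewrite mean_cst mul1r.
Qed.

End Positive.
End Mean.

(** * The quadratic form and its behaviour under exponential tilts *)

Section LeonPerron.
Context {R : realType} {N : nat} (mu : 'rV[R]_N) (lam : R).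
Context (hmu : positive_distribution mu) (lam0 : 0 <= lam) (lam1 : lam < 1).
Implicit Types (f g x y : 'I_N -> R) (A : 'M[R]_N).

(* The quadratic form of [lam I + (1 - lam) E_pi]. *)
Definition lpform x : R :=
  lam * mean mu (fun i => x i ^+ 2) + (1 - lam) * mean mu x ^+ 2.

Lemma lpform_ge0 x : 0 <= lpform x.
Proof.
apply: addr_ge0; apply: mulr_ge0 => //; first exact: mean_sqr_ge0.
  by rewrite subr_ge0 ltW.
exact: sqr_ge0.
Qed.

Lemma sqr_mean_le_lpform x : mean mu x ^+ 2 <= lpform x.
Proof.
have : 0 <= lam * (mean mu (fun i => x i ^+ 2) - mean mu x ^+ 2).
  by rewrite mulr_ge0// subr_ge0 sqr_mean_le.
by rewrite /lpform; lra.
Qed.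

Lemma lpform_le x : lpform x <= mean mu (fun i => x i ^+ 2).
Proof.
have : 0 <= (1 - lam) * (mean mu (fun i => x i ^+ 2) - mean mu x ^+ 2).
  by rewrite mulr_ge0 ?subr_ge0 ?sqr_mean_le// ltW.
by rewrite /lpform; lra.
Qed.

(** Split [g] into its mean and a centered part [h]. As [f] is centered, the first order term acting
    on the square of the mean averages out, and every other first order term involves [h]. *)
Lemma lpform_tilt_small (b : R) f g :
  (forall i, `|f i| <= b) -> mean mu f = 0 -> 32 * b <= 1 - lam ->
  lpform (fun i => expR (f i / 2) * g i)
    <= (1 + 32 * b ^+ 2 / (1 - lam)) * mean mu (fun i => g i ^+ 2).
Proof.
move=> fb f0 bd.
set c := mean mu g; pose h i := g i - c.
have gE i : g i = c + h i by rewrite /h addrC subrK.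
have h0 : mean mu h = 0.
  by rewrite meanD (mean_cst hmu) subrr.
set V := mean mu (fun i => h i ^+ 2).
have V0 : 0 <= V by exact: mean_sqr_ge0.
have g2 : mean mu (fun i => g i ^+ 2) = c ^+ 2 + V.
  rewrite -[c ^+ 2](mean_cst hmu) -[V]addr0 -[X in _ + (_ + X)](mulr0 (2 * c)).
  rewrite -h0 -(meanZ mu _ h) -!meanD; apply: eq_mean => i; rewrite gE; ring.
have b0 : 0 <= b.
  rewrite -(mean_cst hmu b); apply: (mean_ge0 hmu) => i.
  exact: le_trans (fb i).
have b32 : b <= 1 / 32 by move: lam0 bd => l0 k; lra.
have f2 i : f i ^+ 2 <= b ^+ 2.
  by rewrite -[f i ^+ 2]real_normK ?num_real// lerXn2r ?nnegrE.
have fhalf i : `|f i / 2| <= 1 / 2.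
  by rewrite normrM (ger0_norm (x := 2^-1))//; have := fb i; lra.
pose p i := expR (f i / 2).
have pb i : (p i - 1) ^+ 2 <= b ^+ 2.
  have := expR_dist_le (fhalf i).
  rewrite normrM (ger0_norm (x := 2^-1))// => pf.
  rewrite -[(_ - 1) ^+ 2]real_normK ?num_real// lerXn2r ?nnegrE//.
  by have := fb i; rewrite /p; lra.
pose q := mean mu p; pose s := mean mu (fun i => (p i - 1) * h i).
pose r := mean mu (fun i => f i * h i).
have pgE : mean mu (fun i => p i * g i) = c * q + s.
  rewrite -[s]addr0 -h0 -(meanZ mu c p) -!meanD.
  by apply: eq_mean => i; rewrite gE; ring.
rewrite /lpform g2 pgE.
apply: (@tilt_arith R lam b c V _ q s r) => //.
(* Adding a multiple of [mean mu f], which is zero, supplies the linear term of the expansion, so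
   that the bound can be checked pointwise. *)
- rewrite -(mean_cst hmu 1) -[X in X <= _]addr0 -[X in _ + X](mulr0 (1 / 2)).
  rewrite -f0 -meanZ -meanD; apply: (le_mean hmu) => i.
  by have := expR_ge1Dx (f i / 2); rewrite /p; lra.
- rewrite -[X in _ <= X]addr0 -[X in _ + X](mulr0 (1 / 2)).
  rewrite -f0 -(mean_cst hmu (1 + _)) -meanZ -meanD.
  apply: (le_mean hmu) => i.
  have := @expR_le_quad _ (f i / 2) (le_trans (ler_norm _) (fhalf i)).
  by have := f2 i; rewrite /p; lra.
- apply: le_trans (mean_cauchy_schwarz hmu _ _) _.
  apply: ler_wpM2r => //; rewrite -(mean_cst hmu (b ^+ 2)).
  exact: (le_mean hmu).
- apply: le_trans (mean_cauchy_schwarz hmu _ _) _.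
  apply: ler_wpM2r => //; rewrite -(mean_cst hmu (b ^+ 2)).
  exact: (le_mean hmu).
(* In f g^2 = c^2 f + 2 c f h + f h^2 the first term has mean zero, the second gives [r], and the
   third is at most b h^2. *)
- rewrite -g2 -[X in _ <= X]addr0 -[X in _ + X](mulr0 (c ^+ 2)) -f0.
  rewrite -(meanZ mu _ f) -(meanZ mu (2 * c) (fun i => f i * h i)).
  rewrite -(meanZ mu b (fun i => h i ^+ 2)) -(meanZ mu _ (fun i => g i ^+ 2)).
  rewrite -!meanD; apply: (le_mean hmu) => i.
  have -> : (expR (f i / 2) * g i) ^+ 2 = expR (f i) * g i ^+ 2.
    by rewrite exprMn -expRM_natl; congr (expR _ * _); field.
  have fx : f i <= 1 / 2 by have := fb i; have := ler_norm (f i); lra.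
  have h1 := expR_le_quad fx; have h2 := f2 i.
  have h3 : f i <= b by have := fb i; have := ler_norm (f i); lra.
  have h4 : expR (f i) * g i ^+ 2 <= (1 + f i + 2 * b ^+ 2) * g i ^+ 2.
    by apply: ler_wpM2r; [exact: sqr_ge0|lra].
  have h5 : f i * h i ^+ 2 <= b * h i ^+ 2.
    by apply: ler_wpM2r => //; exact: sqr_ge0.
  by move: h4; rewrite gE; lra.
Qed.

(* A shift [b] too large for the second order expansion is already paid for
   by the trivial bound [expR b]. *)
Lemma lpform_tilt (b : R) f g :
  (forall i, `|f i| <= b) -> mean mu f = 0 ->
  lpform (fun i => expR (f i / 2) * g i)
    <= expR (32 * b ^+ 2 / (1 - lam)) * mean mu (fun i => g i ^+ 2).
Proof.
move=> fb f0; have d0 : 0 < 1 - lam by rewrite subr_gt0.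
have [bd|bd] := leP (32 * b) (1 - lam).
  apply: le_trans (lpform_tilt_small g fb f0 bd) _.
  by apply: ler_wpM2r; [exact: mean_sqr_ge0|exact: expR_ge1Dx].
apply: le_trans (lpform_le _) _; rewrite -meanZ; apply: (le_mean hmu) => i.
rewrite exprMn; apply: ler_wpM2r; first exact: sqr_ge0.
rewrite -expRM_natl ler_expR; apply: (@le_trans _ _ b).
  by have := fb i; have := ler_norm (f i); lra.
by rewrite ler_pdivlMr//; nra.
Qed.

End LeonPerron.

(** * The transition operator, its norm, and the moment generating function *)

Section TransitionOperator.
Context {R : realType} {N : nat} (mu : 'rV[R]_N) (A : 'M[R]_N).
Context (hmu : positive_distribution mu) (hA : row_stochastic A)
  (hst : stationary_distribution mu A).
Implicit Types f x y : 'I_N -> R.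

Definition transition x : 'I_N -> R := fun i => \sum_j A i j * x j.

Lemma transition_ge0 x : (forall i, 0 <= x i) -> forall i, 0 <= transition x i.
Proof.
by move=> x0 i; apply: sumr_ge0 => j _; rewrite mulr_ge0// (proj1 hA).
Qed.

Lemma transition_cst (c : R) i : transition (fun=> c) i = c.
Proof. by rewrite /transition -mulr_suml (proj2 hA) mul1r. Qed.

Lemma transitionD x y i :
  transition (fun j => x j + y j) i = transition x i + transition y i.
Proof. by rewrite -big_split; apply: eq_bigr => j _; rewrite mulrDr. Qed.

Lemma mean_transition x : mean mu (transition x) = mean mu x.
Proof.
rewrite /mean /transition; under eq_bigr do rewrite mulr_sumr.
rewrite exchange_big; apply: eq_bigr => j _.
under eq_bigr do rewrite mulrA.
by rewrite -mulr_suml -{2}hst mxE.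
Qed.

(** Jensen's inequality: row [i] is a probability vector, and the variance of [x] under it is
    nonnegative. *)
Lemma sqr_transition_le x i :
  transition x i ^+ 2 <= transition (fun j => x j ^+ 2) i.
Proof.
set m := transition x i.
have : 0 <= transition (fun j => (x j - m) ^+ 2) i.
  by apply: transition_ge0 => j; exact: sqr_ge0.
have -> : transition (fun j => (x j - m) ^+ 2) i
    = transition (fun j => x j ^+ 2) i - m ^+ 2.
  transitivity (transition (fun j => x j ^+ 2) i + ((- 2 * m) * m + m ^+ 2)).
    rewrite -[m ^+ 2](transition_cst _ i) {3}/m /transition mulr_sumr.
    rewrite -!big_split.
    by apply: eq_bigr => j _ /=; ring.
  by ring.
by rewrite subr_ge0.
Qed.

Lemma mean_centered_transition x :
  mean mu (fun i => (transition x i - mean mu x) ^+ 2)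
    = mean mu (fun i => transition x i ^+ 2) - mean mu x ^+ 2.
Proof.
transitivity (mean mu (fun i => transition x i ^+ 2)
    + (- 2 * mean mu x) * mean mu (transition x) + mean mu x ^+ 2); last first.
  by rewrite mean_transition; ring.
rewrite -[mean mu x ^+ 2](mean_cst hmu) -meanZ -!meanD.
by apply: eq_mean => i; ring.
Qed.

(** Jensen and stationarity make the operator a contraction, and centering only decreases the second
    moment. This bounds the set whose supremum defines the operator norm. *)
Lemma mean_centered_transition_le x :
  mean mu (fun i => (transition x i - mean mu x) ^+ 2)
    <= mean mu (fun i => x i ^+ 2).
Proof.
rewrite mean_centered_transition.
apply: (@le_trans _ _ (mean mu (fun i => transition x i ^+ 2))).
  by rewrite gerBl sqr_ge0.
rewrite -[leRHS]mean_transition.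
by apply: (le_mean hmu) => i; exact: sqr_transition_le.
Qed.

Lemma L2norm_mean (v : 'cV[R]_N) :
  L2norm mu v = Num.sqrt (mean mu (fun i => v i 0 ^+ 2)).
Proof.
rewrite /L2norm; congr Num.sqrt; apply: eq_bigr => i _.
by rewrite real_normK// num_real.
Qed.

Lemma centered_transition_mx x i :
  ((A - averaging_mx mu) *m (\col_j x j)) i 0 = transition x i - mean mu x.
Proof.
rewrite mxE /transition /mean -sumrB; apply: eq_bigr => j _.
by rewrite !mxE mulrBl.
Qed.

Local Notation lam := (L2opnorm mu (A - averaging_mx mu)).

Lemma le_L2opnorm x : mean mu (fun i => x i ^+ 2) = 1 ->
  Num.sqrt (mean mu (fun i => (transition x i - mean mu x) ^+ 2)) <= lam.
Proof.
move=> x1; apply: ub_le_sup.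
  exists 1 => _ [v /= v1 <-]; rewrite L2norm_mean -[leRHS]v1 L2norm_mean.
  have vE : v = \col_j v j 0 by apply/colP => j; rewrite mxE.
  rewrite {1}vE; apply: ler_wsqrtr.
  under eq_mean do rewrite centered_transition_mx.
  exact: mean_centered_transition_le.
exists (\col_j x j) => /=.
  rewrite L2norm_mean; under eq_mean do rewrite mxE.
  by rewrite x1 sqrtr1.
by rewrite L2norm_mean; under eq_mean do rewrite centered_transition_mx.
Qed.

Lemma L2opnorm_centered_ge0 : 0 <= lam.
Proof.
apply: le_trans (sqrtr_ge0 _) (@le_L2opnorm (fun=> 1) _).
by rewrite (mean_cst hmu (1 ^+ 2)) expr1n.
Qed.

Lemma mean_centered_transition_opnorm x :
  mean mu (fun i => (transition x i - mean mu x) ^+ 2)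
    <= lam ^+ 2 * mean mu (fun i => x i ^+ 2).
Proof.
(* A function of zero norm cannot be normalised; there the contraction bound already gives zero on
   the left. *)
have [V0|] := ltP 0 (mean mu (fun i => x i ^+ 2)); last first.
  move=> V0; apply: le_trans (mean_centered_transition_le x) _.
  apply: le_trans V0 _; apply: mulr_ge0; first exact: sqr_ge0.
  exact: mean_sqr_ge0.
set V := mean mu _ in V0 *.
pose c := (Num.sqrt V)^-1.
have c0 : 0 <= c by rewrite invr_ge0 sqrtr_ge0.
have cV : c ^+ 2 * V = 1.
  by rewrite /c exprVn sqr_sqrtr ?mulVf ?gt_eqF// ltW.
have h : mean mu (fun i => (c * x i) ^+ 2) = 1.
  by under eq_mean do rewrite exprMn; rewrite meanZ cV.
have := le_L2opnorm h.
have -> : mean mu (fun i => (transition (fun j => c * x j) i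
    - mean mu (fun j => c * x j)) ^+ 2)
  = c ^+ 2 * mean mu (fun i => (transition x i - mean mu x) ^+ 2).
  rewrite -meanZ; apply: eq_mean => i; rewrite meanZ -exprMn mulrBr.
  congr ((_ - _) ^+ 2); rewrite /transition mulr_sumr.
  by apply: eq_bigr => j _; rewrite mulrCA.
set W := mean mu _; move=> cW.
have W0 : 0 <= W by exact: mean_sqr_ge0.
have cW2 : c ^+ 2 * W <= lam ^+ 2.
  rewrite -[leLHS]sqr_sqrtr ?mulr_ge0 ?sqr_ge0//.
  by rewrite lerXn2r// nnegrE ?sqrtr_ge0// L2opnorm_centered_ge0.
have -> : W = V * (c ^+ 2 * W) by rewrite mulrA [V * _]mulrC cV mul1r.
by rewrite [leRHS]mulrC ler_wpM2l // ltW.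
Qed.

Context (lam1 : lam < 1).

(* [<x, A y> = <x><y> + <x - <x>, (A - E)(y - <y>)>], then Cauchy-Schwarz in
   the plane. *)
Lemma mean_transition_lpform x y :
  mean mu (fun i => x i * transition y i) ^+ 2
    <= lpform mu lam x * lpform mu lam y.
Proof.
set m := mean mu x; set n := mean mu y.
pose x0 i := x i - m; pose y0 i := y i - n.
have var z : mean mu (fun i => (z i - mean mu z) ^+ 2)
    = mean mu (fun i => z i ^+ 2) - mean mu z ^+ 2.
  transitivity (mean mu (fun i => z i ^+ 2)
      + (- 2 * mean mu z) * mean mu z + mean mu z ^+ 2); last by ring.
  rewrite -[mean mu z ^+ 2](mean_cst hmu) -(meanZ mu _ z) -!meanD.
  by apply: eq_mean => i; ring.
have mean0 z : mean mu (fun i => z i - mean mu z) = 0.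
  by rewrite meanD (mean_cst hmu) subrr.
have ty0 i : transition y0 i = transition y i - n.
  by rewrite transitionD transition_cst.
set s := mean mu (fun i => x0 i * (transition y0 i - mean mu y0)).
have -> : mean mu (fun i => x i * transition y i) = m * n + s.
  transitivity (n * m + (s + m *
      mean mu (fun i => transition y i - mean mu (transition y)))).
    rewrite mean_transition -(meanZ mu n x) -(meanZ mu m) -!meanD.
    by apply: eq_mean => i; rewrite ty0 (mean0 y) /x0 /n; ring.
  by rewrite mean0; ring.
set X := mean mu (fun i => x0 i ^+ 2); set Y := mean mu (fun i => y0 i ^+ 2).
have X0 : 0 <= X by exact: mean_sqr_ge0.
have Y0 : 0 <= Y by exact: mean_sqr_ge0.
have l0 := L2opnorm_centered_ge0.
have sXY : s ^+ 2 <= lam ^+ 2 * (X * Y).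
  apply: le_trans (mean_cauchy_schwarz hmu _ _) _.
  rewrite mulrCA; apply: ler_wpM2l => //.
  exact: mean_centered_transition_opnorm.
have -> : lpform mu lam x = m ^+ 2 + lam * X.
  by rewrite /lpform /X /x0 var /m; ring.
have -> : lpform mu lam y = n ^+ 2 + lam * Y.
  by rewrite /lpform /Y /y0 var /n; ring.
move: (lam) l0 sXY => l l0 sXY.
(* These are the cross terms of (m n + s)^2 and of (m^2 + l X)(n^2 + l Y); the remaining terms are
   compared by [sXY]. *)
have : 2 * (m * n * s) <= l * (m ^+ 2 * Y) + l * (n ^+ 2 * X).
  apply: le_addr_of_sqr.
  - by apply: mulr_ge0 => //; apply: mulr_ge0 => //; exact: sqr_ge0.
  - by apply: mulr_ge0 => //; apply: mulr_ge0 => //; exact: sqr_ge0.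
  have -> : 4 * (l * (m ^+ 2 * Y) * (l * (n ^+ 2 * X)))
    = 4 * (m * n) ^+ 2 * (l ^+ 2 * (X * Y)) by ring.
  have -> : (2 * (m * n * s)) ^+ 2 = 4 * (m * n) ^+ 2 * s ^+ 2 by ring.
  by apply: ler_wpM2l => //; have := sqr_ge0 (m * n); lra.
by lra.
Qed.

Lemma lpform_tilted_transition (b : R) f y :
  (forall i, `|f i| <= b) -> mean mu f = 0 ->
  lpform mu lam (fun i => expR (f i) * transition y i)
    <= expR (32 * b ^+ 2 / (1 - lam)) ^+ 2 * lpform mu lam y.
Proof.
move=> fb f0; set K := expR _.
pose g i := expR (f i / 2) * transition y i.
have K0 : 0 <= K by exact: expR_ge0.
have l0 := L2opnorm_centered_ge0.
have gK := lpform_tilt hmu l0 lam1 g fb f0; rewrite -/K in gK.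
have fE : (fun i => expR (f i) * transition y i)
    = (fun i => expR (f i / 2) * g i).
  by apply: funext => i; rewrite /g mulrA -expRD; congr (expR _ * _); lra.
rewrite fE; apply: (le_trans gK); rewrite expr2 -mulrA; apply: ler_wpM2l => //.
set G := mean mu (fun i => g i ^+ 2).
have y0 : 0 <= lpform mu lam y by exact: lpform_ge0.
have G0 : 0 <= G by exact: mean_sqr_ge0.
(* [G] is bounded through itself: G^2 <= K G Q(y), with Q(y) the form at [y], and one factor [G]
   cancels when it is positive. *)
have [Gp|] := ltP 0 G; last by move/le_trans; apply; rewrite mulr_ge0.
rewrite -(ler_pM2l Gp).
have -> : G * G
    = mean mu (fun i => (expR (f i / 2) * g i) * transition y i) ^+ 2.
  rewrite -expr2; congr (_ ^+ 2); apply: eq_mean => i.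
  by rewrite /g; ring.
apply: le_trans (mean_transition_lpform _ _) _.
by rewrite mulrA [G * K]mulrC; apply: ler_wpM2r.
Qed.

(* [E[exp(g k (Y k) + ... + g (k + m - 1) (Y (k + m - 1))) | Y k = i]]. *)
Fixpoint tilted (g : nat -> 'I_N -> R) m k : 'I_N -> R :=
  if m is m'.+1 then fun i => expR (g k i) * transition (tilted g m' k.+1) i
  else fun=> 1.

Lemma lpform_tilted (b : nat -> R) g m k :
  (forall l i, `|g l i| <= b l) -> (forall l, mean mu (g l) = 0) ->
  lpform mu lam (tilted g m k)
    <= expR (32 * (\sum_(k <= l < k + m) b l ^+ 2) / (1 - lam)) ^+ 2.
Proof.
move=> gb g0; elim: m k => [|m IH] k /=.
  rewrite addn0 big_geq// mulr0 mul0r expR0 /lpform.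
  by rewrite (mean_cst hmu (1 ^+ 2)) (mean_cst hmu 1); lra.
apply: le_trans (lpform_tilted_transition _ (gb k) (g0 k)) _.
rewrite big_ltn; last by rewrite addnS ltnS leq_addr.
rewrite [in leRHS]mulrDr [in leRHS]mulrDl expRD exprMn.
apply: ler_wpM2l; first exact: sqr_ge0.
by rewrite addnS -addSn; exact: IH.
Qed.

(** The squared mean is at most the quadratic form, so this is the square root of the preceding
    bound. *)
Lemma mean_tilted (b : nat -> R) g m k :
  (forall l i, `|g l i| <= b l) -> (forall l, mean mu (g l) = 0) ->
  mean mu (tilted g m k)
    <= expR (32 * (\sum_(k <= l < k + m) b l ^+ 2) / (1 - lam)).
Proof.
move=> gb g0; rewrite leNgt; apply/negP => h.
have := le_trans (sqr_mean_le_lpform hmu L2opnorm_centered_ge0 _)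
  (lpform_tilted m k gb g0).
rewrite leNgt ltr_pXn2r// ?nnegrE ?expR_ge0// ?h//.
by apply: ltW; apply: lt_trans h; exact: expR_gt0.
Qed.

End TransitionOperator.

(** * Path probabilities and tails of the chain *)

Section ChainProbability.
Context {R : realType} {d : measure_display} {Omega : measurableType d}.
Context (P : probability Omega R) {N : nat} (A : 'M[R]_N) (mu : 'rV[R]_N).
Context (Y : nat -> Omega -> 'I_N) (hY : stationary_markov_chain P A mu Y).

Local Notation pr E := (fine (P E)).

Definition past k (x : nat -> 'I_N) : set Omega :=
  [set w | forall l, (l <= k)%N -> Y l w = x l].

Definition extend k (x : nat -> 'I_N) j : nat -> 'I_N :=
  fun l => if (l <= k)%N then x l else j.

Lemma past_extend k x j :
  past k.+1 (extend k x j) = past k x `&` Y k.+1 @^-1` [set j].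
Proof.
apply/seteqP; split => w /=.
  move=> h; split; last by rewrite h// /extend ltnn.
  by move=> l lk; rewrite h ?leqW// /extend lk.
move=> [h hj] l; rewrite leq_eqVlt => /orP[/eqP ->|].
  by rewrite /extend ltnn.
by rewrite ltnS => lk; rewrite /extend lk h.
Qed.

Lemma past0 i : past 0 (fun=> i) = Y 0%N @^-1` [set i].
Proof.
apply/seteqP; split => w /= h; first exact: h.
by move=> l; rewrite leqn0 => /eqP ->.
Qed.

Lemma measurable_past k x : measurable (past k x).
Proof.
elim: k => [|k IH].
  rewrite (_ : past 0 x = past 0 (fun=> x 0%N)).
    by rewrite past0; exact: chain_measurable hY _ _.
  by apply/seteqP; split => w h l; rewrite leqn0 => /eqP ->; exact: h.
rewrite (_ : past k.+1 x = past k.+1 (extend k x (x k.+1))).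
  rewrite past_extend; apply: measurableI => //.
  exact: chain_measurable hY _ _.
have xE l : (l <= k.+1)%N -> extend k x (x k.+1) l = x l.
  by rewrite /extend leq_eqVlt => /orP[/eqP ->|]; rewrite ?ltnn// ltnS => ->.
by apply/seteqP; split => w h l lk; rewrite h// xE.
Qed.

Lemma measurable_fun_chain k (f : 'I_N -> R) :
  measurable_fun setT (fun w => f (Y k w)).
Proof.
move=> _ B mB; rewrite setTI.
rewrite (_ : _ @^-1` B = \bigcup_(j in [set j | B (f j)]) (Y k @^-1` [set j])).
  apply: fin_bigcup_measurable => [|j _]; first exact: finite_finset.
  exact: chain_measurable hY _ _.
by apply/seteqP; split => [w /= Bw|w [j /= Bj ->//]]; exists (Y k w).
Qed.

Lemma bigsetU_visit k B :
  \big[setU/set0]_(j < N) (B `&` Y k @^-1` [set j]) = B.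
Proof.
rewrite -bigcup_seq; apply/seteqP; split => w; first by move=> [j _ []].
by move=> Bw; exists (Y k w) => //=; rewrite mem_index_enum.
Qed.

Lemma total_probability k B : measurable B ->
  pr B = \sum_j pr (B `&` Y k @^-1` [set j]).
Proof.
move=> mB; have mBj j : measurable (B `&` Y k @^-1` [set j]).
  by apply: measurableI => //; exact: chain_measurable hY _ _.
rewrite sum_fine => [|j _]; last exact: fin_num_measure.
rewrite -(measure_bigsetU_ord P) ?bigsetU_visit//.
exact: trivIset_preimage1_in.
Qed.

Lemma pr_ge0 B : 0 <= pr B.
Proof. exact: fine_ge0. Qed.

Lemma le_pr B C : measurable B -> measurable C -> B `<=` C -> pr B <= pr C.
Proof.
move=> mB mC BC; apply: fine_le; rewrite ?fin_num_measure//.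
by apply: le_measure => //; rewrite inE.
Qed.

Lemma pr_past_extend k x j :
  pr (past k.+1 (extend k x j)) = pr (past k x) * A (x k) j.
Proof.
have mp := measurable_past k x.
(* The Markov property says nothing about a null past; there both sides vanish by monotonicity. *)
rewrite past_extend; have [p0|p0] := eqVneq (P (past k x)) 0%E.
  rewrite p0 mul0r; apply/eqP; rewrite eq_le pr_ge0 andbT.
  rewrite -[leRHS]/(fine 0%E) -p0; apply: le_pr => //.
  by apply: measurableI => //; exact: chain_measurable hY _ _.
have := chain_markov hY (k := k) (x := x) j p0.
rewrite /cond_prob setIC => <-; rewrite mulrCA divff ?mulr1//.
by rewrite fine_eq0// fin_num_measure.
Qed.

Lemma pr_past_step k x B : measurable B ->
  pr (past k x `&` B) = \sum_j pr (past k.+1 (extend k x j) `&` B).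
Proof.
move=> mB; have mp := measurable_past k x.
rewrite (total_probability k.+1); last exact: measurableI.
by apply: eq_bigr => j _; rewrite past_extend setIAC.
Qed.

Lemma extend_last k x j : extend k x j k.+1 = j.
Proof. by rewrite /extend ltnn. Qed.

Lemma pr_initial B : measurable B ->
  pr B = \sum_i pr (past 0 (fun=> i) `&` B).
Proof.
move=> mB; rewrite (total_probability 0)//.
by apply: eq_bigr => i _; rewrite past0 setIC.
Qed.

Lemma pr_past0 i : pr (past 0 (fun=> i)) = mu 0 i.
Proof. by rewrite past0 (chain_initial hY). Qed.

(** The Markov property iterated over [m] steps, by conditioning on the next state; the induction
    needs [k] and [x] general. *)
Lemma pr_past_visit m k x j :
  pr (past k x `&` Y (k + m) @^-1` [set j])
    = pr (past k x) * iter m (transition A) (fun i => (i == j)%:R) (x k).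
Proof.
elim: m k x => [|m IH] k x /=.
  rewrite addn0; have [<-|xj] := eqVneq (x k) j.
    rewrite mulr1; congr (fine (P _)); apply/seteqP; split => w; first by case.
    by move=> h; split => //; exact: h.
  rewrite mulr0 (_ : _ `&` _ = set0) ?measure0//.
  by apply/seteqP; split => w // [h /= hj]; rewrite -(h k)// hj eqxx in xj.
rewrite pr_past_step; last exact: chain_measurable hY _ _.
rewrite /transition mulr_sumr; apply: eq_bigr => i _.
by rewrite addnS -addSn IH pr_past_extend extend_last mulrA.
Qed.

(** Stationarity at every time: the transition operator preserves means under [mu]. This is what
    turns the centering hypothesis on expectations into one on [mean mu]. *)
Lemma pr_chain k j : pr (Y k @^-1` [set j]) = mu 0 j.
Proof.
rewrite pr_initial; last exact: chain_measurable hY _ _.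
under eq_bigr do rewrite -[k in Y k]add0n pr_past_visit pr_past0.
rewrite -/(mean mu _).
have -> : mean mu (iter k (transition A) (fun i => (i == j)%:R))
    = mean mu (fun i => (i == j)%:R).
  by elim: k => //= k; rewrite (mean_transition (chain_stationary hY)).
rewrite /mean (bigD1 j)//= eqxx mulr1 big1 ?addr0// => i /negPf ->.
by rewrite mulr0.
Qed.

Lemma expectation_chain k (f : 'I_N -> R) :
  expectation P (fun w => f (Y k w)) = (mean mu f)%:E.
Proof.
have mY j : measurable (Y k @^-1` [set j]) by exact: chain_measurable hY _ _.
rewrite unlock -[X in integral _ X](bigsetU_visit k).
rewrite integral_bigsetU_EFin /=; last 4 first.
- by move=> j; rewrite setTI.
- exact: index_enum_uniq.
- exact: trivIset_preimage1_in.
- rewrite bigsetU_visit; apply/measurable_EFinP; exact: measurable_fun_chain.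
rewrite /mean -sumEFin; apply: eq_bigr => j _; rewrite setTI.
transitivity (\int[P]_(w in Y k @^-1` [set j]) (cst (f j)%:E w))%E.
  by apply: eq_integral => w; rewrite inE /= => ->.
by rewrite integral_cst// -(pr_chain k j) EFinM fineK ?fin_num_measure// muleC.
Qed.

Lemma measurable_tail (g : nat -> 'I_N -> R) a b r :
  measurable [set w | r <= \sum_(a <= l < b) g l (Y l w)].
Proof.
rewrite (_ : [set w | _] =
  (fun w => \sum_(a <= l < b) g l (Y l w)) @^-1` `[r, +oo[).
  rewrite -[X in measurable X]setTI; apply: measurable_sum => //.
  move=> l; exact: measurable_fun_chain.
by apply/seteqP; split => w /=; rewrite in_itv/= andbT.
Qed.

(** Chernoff's bound conditioned on the past, proved by induction on the number of remaining steps,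
    so that no conditional expectation is formed. *)
Lemma pr_past_tail (g : nat -> 'I_N -> R) m k x r :
  pr (past k x `&` [set w | r <= \sum_(k.+1 <= l < k.+1 + m) g l (Y l w)])
    <= pr (past k x) * (expR (- r) * transition A (tilted A g m k.+1) (x k)).
Proof.
elim: m k x r => [|m IH] k x r.
  have mp := measurable_past k x.
  rewrite addn0 (transition_cst (chain_row_stochastic hY)) mulr1.
  (* For the empty sum the event is the condition r <= 0, whose indicator is at most e^(-r). *)
  have [r0|r0] := leP r 0.
    apply: (@le_trans _ _ (pr (past k x))).
      apply: le_pr => //; apply: measurableI => //.
      by have := measurable_tail g k.+1 k.+1 r.
    by rewrite ler_peMr ?pr_ge0// -expR0 ler_expR oppr_ge0.
  rewrite (_ : _ `&` _ = set0) ?measure0 ?mulr_ge0 ?pr_ge0 ?expR_ge0//.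
  by apply/seteqP; split => w // [_ /=]; rewrite big_geq// leNgt r0.
rewrite pr_past_step; last exact: measurable_tail.
rewrite /transition !mulr_sumr; apply: ler_sum => j _ /=.
set E := _ `&` _.
(* Once the next state is [j], its contribution is a constant and moves into the threshold. *)
have -> : E = past k.+1 (extend k x j) `&`
    [set w | r - g k.+1 j <= \sum_(k.+2 <= l < k.+2 + m) g l (Y l w)].
  have sumE w : past k.+1 (extend k x j) w ->
      \sum_(k.+1 <= l < k.+1 + m.+1) g l (Y l w)
        = g k.+1 j + \sum_(k.+2 <= l < k.+2 + m) g l (Y l w).
    move=> h; rewrite big_ltn; last by rewrite addnS ltnS leq_addr.
    by rewrite (h k.+1)// extend_last -addSnnS.
  apply/seteqP; split => w [h /=] rw; split => //=; move: rw.
    by rewrite sumE// lerBlDl.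
  by rewrite sumE// lerBlDl.
apply: le_trans (IH _ _ _) _.
rewrite pr_past_extend extend_last opprB expRD.
by rewrite le_eqVlt; apply/predU1P; left; ring.
Qed.

Lemma pr_tail (g : nat -> 'I_N -> R) m r :
  pr [set w | r <= \sum_(0 <= l < m.+1) g l (Y l w)]
    <= expR (- r) * mean mu (tilted A g m.+1 0).
Proof.
rewrite pr_initial; last exact: measurable_tail.
rewrite /mean mulr_sumr; apply: ler_sum => j _ /=.
set E := _ `&` _.
have -> : E = past 0 (fun=> j) `&`
    [set w | r - g 0%N j <= \sum_(1 <= l < 1 + m) g l (Y l w)].
  have sumE w : past 0 (fun=> j) w -> \sum_(0 <= l < m.+1) g l (Y l w)
      = g 0%N j + \sum_(1 <= l < 1 + m) g l (Y l w).
    by move=> h; rewrite big_ltn// (h 0%N).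
  apply/seteqP; split => w [h /=] rw; split => //=; move: rw.
    by rewrite sumE// lerBlDl.
  by rewrite sumE// lerBlDl.
apply: le_trans (pr_past_tail _ _ _ _ _) _.
by rewrite pr_past0 opprB expRD; rewrite le_eqVlt; apply/predU1P; left; ring.
Qed.

End ChainProbability.

(** * One-sided and two-sided tail bounds *)

Lemma one_sided_tail (R : realType) (d : measure_display)
    (Omega : measurableType d) (P : probability Omega R)
    (N : nat) (A : 'M[R]_N) (mu : 'rV[R]_N) (Y : nat -> Omega -> 'I_N)
    (hmu : positive_distribution mu)
    (hY : stationary_markov_chain P A mu Y)
    (n : nat) (a : 'I_n.+1 -> R) (f : 'I_n.+1 -> 'I_N -> R)
    (hmean : forall i, mean mu (f i) = 0)
    (hbound : forall i v, `|f i v| <= a i) (t r : R) :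
  0 <= t -> L2opnorm mu (A - averaging_mx mu) < 1 ->
  fine (P [set w | t * r <= t * \sum_(i < n.+1) f i (Y i w)])
    <= expR (32 * t ^+ 2 * (\sum_(i < n.+1) a i ^+ 2)
               / (1 - L2opnorm mu (A - averaging_mx mu)) - t * r).
Proof.
move=> t0 lam1.
(* Extension by zero to all times: the hypotheses then hold at every natural number, and sums up to
   [n.+1] are unaffected. *)
pose g l v := oapp (fun i => t * f i v) 0 (insub l : option 'I_n.+1).
pose b l := oapp (fun i => t * a i) 0 (insub l : option 'I_n.+1).
have gb l v : `|g l v| <= b l.
  rewrite /g /b; case: insub => [i|] /=; last by rewrite normr0.
  by rewrite normrM (ger0_norm t0) ler_wpM2l.
have g0 l : mean mu (g l) = 0.
  rewrite /g; case: insub => [i|] /=; first by rewrite meanZ hmean mulr0.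
  exact: mean_cst.
have -> : [set w | t * r <= t * \sum_(i < n.+1) f i (Y i w)]
    = [set w | t * r <= \sum_(0 <= l < n.+1) g l (Y l w)].
  apply/funext => w /=; congr (is_true (_ <= _)).
  by rewrite big_mkord mulr_sumr; apply: eq_bigr => i _; rewrite /g valK.
have bE : \sum_(0 <= l < 0 + n.+1) b l ^+ 2 = t ^+ 2 * \sum_(i < n.+1) a i ^+ 2.
  rewrite big_mkord mulr_sumr; apply: eq_bigr => i _.
  by rewrite /b valK /= exprMn.
apply: le_trans (pr_tail hY g n (t * r)) _.
rewrite addrC expRD; apply: ler_wpM2l; first exact: expR_ge0.
have := mean_tilted hmu (chain_row_stochastic hY) (chain_stationary hY)
  lam1 n.+1 0 gb g0.
by rewrite bE mulrA.
Qed.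

Theorem theorem1p1 (R : realType) (d : measure_display)
    (Omega : measurableType d) (P : probability Omega R)
    (N : nat) (A : 'M[R]_N) (mu : 'rV[R]_N) (Y : nat -> Omega -> 'I_N)
    (hmu : positive_distribution mu)
    (hY : stationary_markov_chain P A mu Y)
    (n : nat) (a : 'I_n -> R) (f : 'I_n -> 'I_N -> R)
    (* excludes a = 0, where the event below is certain for every u *)
    (ha : exists i, a i != 0)
    (hmean : forall i : 'I_n, expectation P (fun w => f i (Y i w)) = 0%:E)
    (hbound : forall (i : 'I_n) (v : 'I_N), `|f i v| <= a i)
    (u : R) (hu : 0 <= u) :
  let lambda := L2opnorm mu (A - averaging_mx mu) in
  (P [set w | (u * Num.sqrt (\sum_(i < n) a i ^+ 2)
                <= `|\sum_(i < n) f i (Y i w)|)%R]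
   <= (2 * expR (- (u ^+ 2 * (1 - lambda) / (64 * expR 1))))%:E)%E.
Proof.
cbv zeta; set lambda := L2opnorm mu _.
case: n a f ha hmean hbound => [|n] a f [i0 ai0] hmean hbound.
  by case: (i0) => [].
have mS (s : R) : measurable_fun setT
    (fun w => s * \sum_(i < n.+1) f i (Y i w)).
  apply: measurable_funM => //; apply: measurable_sum => i.
  exact: measurable_fun_chain hY _ _.
have mtail (s c : R) :
    measurable [set w | c <= s * \sum_(i < n.+1) f i (Y i w)].
  rewrite (_ : [set w | _] =
    (fun w => s * \sum_(i < n.+1) f i (Y i w)) @^-1` `[c, +oo[).
    by rewrite -[X in measurable X]setTI; exact: mS.
  by apply/seteqP; split => w /=; rewrite in_itv/= andbT.
set rho := Num.sqrt _.
have tailE : [set w | u * rho <= `|\sum_(i < n.+1) f i (Y i w)|]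
    = [set w | u * rho <= 1 * \sum_(i < n.+1) f i (Y i w)]
      `|` [set w | u * rho <= - 1 * \sum_(i < n.+1) f i (Y i w)].
  apply/seteqP; split => w /=; rewrite mul1r mulN1r.
    by rewrite ler_normr => /orP.
  by move=> h; rewrite ler_normr; apply/orP.
rewrite tailE.
(* Without a spectral gap the exponent is nonnegative, so the claimed bound is at least 2. *)
have [lam1|lam1] := leP 1 lambda.
  apply: (le_trans (probability_le1 _ _)); first exact: measurableU.
  rewrite lee_fin; apply: (@le_trans _ _ (2 * expR 0)).
    by rewrite expR0; lra.
  rewrite ler_pM2l// ler_expR oppr_ge0.
  rewrite pmulr_lle0 ?invr_gt0 ?mulr_gt0 ?expR_gt0//.
  by rewrite mulr_ge0_le0 ?sqr_ge0// subr_le0.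
have d0 : 0 < 1 - lambda by rewrite subr_gt0.
have S0 : 0 < \sum_(i < n.+1) a i ^+ 2.
  rewrite (bigD1 i0)//=; apply: ltr_pwDl.
    by rewrite lt_def sqrf_eq0 ai0 sqr_ge0.
  by apply: sumr_ge0 => i _; exact: sqr_ge0.
have rho0 : 0 < rho by rewrite sqrtr_gt0.
have rho2 : rho ^+ 2 = \sum_(i < n.+1) a i ^+ 2 by rewrite sqr_sqrtr// ltW.
(* The sign [s] treats both tails at once, by passing from [f] to [s * f]. *)
have side (s : R) : `|s| = 1 ->
    (P [set w | (u * rho <= s * \sum_(i < n.+1) f i (Y i w))%R]
      <= (expR (- (u ^+ 2 * (1 - lambda) / (64 * expR 1))))%:E)%E.
  move=> s1; rewrite -[P _]fineK ?fin_num_measure// lee_fin.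
  (* The minimiser of 32 t^2 rho^2 / (1 - lambda) - t u rho; the minimum is - u^2 (1 - lambda) /
     128. *)
  pose t := u * (1 - lambda) / (64 * rho).
  have t0 : 0 <= t by rewrite divr_ge0 ?mulr_ge0// ?ltW// mulr_gt0.
  have smean i : mean mu (fun v => s * f i v) = 0.
    rewrite meanZ (_ : mean mu (f i) = 0) ?mulr0//.
    by have := hmean i; rewrite (expectation_chain hY) => -[].
  have sbound i v : `|s * f i v| <= a i by rewrite normrM s1 mul1r.
  have := one_sided_tail hmu hY smean sbound (u * rho) t0 lam1.
  set T := [set w | _]; move=> tailT.
  apply: (@le_trans _ _ (fine (P T))).
    apply: le_pr => //.
      have -> : T =
          [set w | t * (u * rho) <= (t * s) * \sum_(i < n.+1) f i (Y i w)].
        by apply/funext => w; rewrite /T /= -mulr_sumr -[t * s * _]mulrA.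
      exact: mtail.
    by move=> w /= h; rewrite /T /= -mulr_sumr ler_wpM2l.
  apply: (le_trans tailT); rewrite ler_expR -rho2 -/lambda.
  have -> : 32 * t ^+ 2 * rho ^+ 2 / (1 - lambda) - t * (u * rho)
      = - (u ^+ 2 * (1 - lambda) / 128).
    by rewrite /t; field; rewrite !gt_eqF.
  rewrite lerN2; apply: ler_wpM2l; first by rewrite mulr_ge0 ?sqr_ge0// ltW.
  rewrite lef_pV2 ?posrE ?mulr_gt0 ?expR_gt0//.
  (* It remains that 128 <= 64 e, that is e >= 2. *)
  have := @expR_ge1Dx R 1; lra.
apply: (le_trans (measureU2 _ _ _)) => //.
rewrite mulrDl mul1r EFinD; apply: leeD; apply: side.
  exact: normr1.
by rewrite normrN normr1.
Qed.
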